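(* Let $\pi(\cdot\,|\,\mathbf{x})$ be a smooth positive probability density on $\Theta=\mathbb{R}^d$ with $\log\pi$ smooth. Let $f_0,\dots,f_K:\Theta\to\mathbb{R}$ be smooth functions and let $A^0,\dots,A^K\in\mathbb{R}^{d\times d}$ be symmetric matrices (not necessarily positive) such that $A(\theta)=\sum_{k=0}^K A^kf_k(\theta)$ is a symmetric positive definite matrix for every $\theta\in\Theta$, with $\theta\mapsto A(\theta)^{1/2}$ smooth. Let $\eta_0,\dots,\eta_K>0$. Consider the extended adaptive Langevin dynamics on $(\theta,p,\xi_0,\dots,\xi_K)\in\Theta\times\mathbb{R}^d\times(\mathbb{R}^{d\times d})^{K+1}$: $$\begin{aligned}d\theta_t&=p_t\,dt,\\ dp_t&=\nabla_\theta\log\pi(\theta_t|\mathbf{x})\,dt-\xi_t(\theta_t)p_t\,dt+\sqrt{2}A(\theta_t)^{1/2}dW_t,\\ d[\xi_{k,t}]_{i,j}&=\frac{f_k(\theta_t)}{\eta_k}\big(p_{i,t}p_{j,t}-\delta_{i,j}\big)\,dt,\qquad 1\le i,j\le d,\ 0\le k\le K,\end{aligned}$$ where $\xi_t(\theta)=\sum_{k=0}^K\xi_{k,t}f_k(\theta)$ and $W$ is a standard $d$-dimensional Brownian motion. Then the probability measure $$\nu_K(d\theta\,dp\,d\xi_0\cdots d\xi_K)=\pi(\theta|\mathbf{x})\,d\theta\;\tau(dp)\;\prod_{k=0}^K\prod_{i,j=1}^d\sqrt{\frac{\eta_k}{2\pi}}\exp\Big(-\frac{\eta_k}{2}\big([\xi_k]_{i,j}-[A^k]_{i,j}\big)^2\Big)\,d[\xi_k]_{i,j},$$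 with $\tau(dp)=(2\pi)^{-d/2}e^{-|p|^2/2}dp$, is invariant for this dynamics: for every smooth compactly supported function $\varphi$, $\int\mathcal{L}\varphi\,d\nu_K=0$, where $\mathcal{L}$ is the generator of the dynamics. In particular the marginal of $\nu_K$ in $\theta$ is $\pi(\cdot|\mathbf{x})$.
   Context: $[\xi_k]_{i,j}$ denotes the $(i,j)$ entry of $\xi_k\in\mathbb{R}^{d\times d}$; all $d^2$ entries of each $\xi_k$ are treated as independent variables. In the paper's application, $A(\theta)=\Gamma+\frac{\epsilon(n)\Delta t}{2}\Sigma_{\mathbf{x}}(\theta)$ with $\Gamma$ a friction matrix and $\Sigma_{\mathbf{x}}$ the covariance of a stochastic gradient estimator, and the hypothesis is that this matrix decomposes on the basis $f_0,\dots,f_K$. The generator is $\mathcal{L}=p^T\nabla_\theta+\nabla_\theta(\log\pi)^T\nabla_p-p^T\xi(\theta)^T\nabla_p+A(\theta):\nabla_p^2+\sum_{k=0}^K\frac{f_k(\theta)}{\eta_k}\sum_{i,j}(p_ip_j-\delta_{i,j})\partial_{[\xi_k]_{i,j}}$ (with $\xi(\theta)p$ the drift term in $p$), where $M^1:M^2=\sum_{i,j}M^1_{i,j}M^2_{i,j}$. *)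

(* Defs.v *)
From HB Require Import structures.
From mathcomp Require Import all_boot all_order all_algebra.
From mathcomp Require Import all_classical all_reals all_analysis.
Set Implicit Arguments. Unset Strict Implicit. Unset Printing Implicit Defensive.
Import Order.TTheory GRing.Theory Num.Theory.
Import numFieldNormedType.Exports.
Local Open Scope ring_scope.

(* Points of R^I (I a finite index type) are functions I -> R. *)

Definition update (R : realType) (I : finType) (z : I -> R) (i : I) (t : R) : I -> R :=
  fun j => if j == i then t else z j.

Definition partial (R : realType) (I : finType) (i : I) (f : (I -> R) -> R) : (I -> R) -> R :=
  fun z => derive1 (fun t => f (update z i t)) (z i).

Definition contR (R : realType) (I : finType) (f : (I -> R) -> R) : Prop :=
  forall (z : I -> R) (e : R), 0 < e -> exists2 dl : R, 0 < dl &
    forall w : I -> R, (forall i, `|w i - z i| < dl) -> `|f w - f z| < e.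

Fixpoint Ck (R : realType) (I : finType) (k : nat) (f : (I -> R) -> R) : Prop :=
  contR f /\
  match k with
  | 0 => True
  | k'.+1 => (forall (i : I) (z : I -> R), derivable (fun t => f (update z i t)) (z i) 1)
             /\ forall i : I, Ck k' (partial i f)
  end.

Definition smooth (R : realType) (I : finType) (f : (I -> R) -> R) : Prop :=
  forall k, Ck k f.

Definition compact_support (R : realType) (I : finType) (f : (I -> R) -> R) : Prop :=
  exists M : R, forall z : I -> R, (exists i, M < `|z i|) -> f z = 0.

(* Iterated Lebesgue integration over the coordinates listed in s
   (real-valued version, used for integrable integrands) *)
Fixpoint iint (R : realType) (I : finType) (s : seq I) (F : (I -> R) -> R) (z : I -> R) : R :=
  match s with
  | [::] => F z
  | i :: s' => Rintegral (@lebesgue_measure R) setT (fun t => iint s' F (update z i t))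
  end.

(* extended-real valued version, used for nonnegative integrands (Tonelli) *)
Fixpoint eiint (R : realType) (I : finType) (s : seq I) (F : (I -> R) -> R) (z : I -> R)
  : \bar R :=
  match s with
  | [::] => (F z)%:E
  | i :: s' => (\int[@lebesgue_measure R]_(t in setT) eiint s' F (update z i t))%E
  end.

Definition integral_Rn (R : realType) (I : finType) (F : (I -> R) -> R) : R :=
  iint (enum I) F (fun _ => 0).
Definition eintegral_Rn (R : realType) (I : finType) (F : (I -> R) -> R) : \bar R :=
  eiint (enum I) F (fun _ => 0).

Definition sym_mx (R : realType) (d : nat) (M : 'M[R]_d) : Prop := M^T = M.
Definition posdef_mx (R : realType) (d : nat) (M : 'M[R]_d) : Prop :=
  sym_mx M /\ forall v : 'I_d -> R, (exists i, v i != 0) ->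
    0 < \sum_(i < d) \sum_(j < d) v i * M i j * v j.
Definition possemidef_mx (R : realType) (d : nat) (M : 'M[R]_d) : Prop :=
  sym_mx M /\ forall v : 'I_d -> R,
    0 <= \sum_(i < d) \sum_(j < d) v i * M i j * v j.

Definition SIdx (d K : nat) : finType := ('I_d + 'I_d + ('I_K.+1 * 'I_d * 'I_d))%type.

Section State.
Variables (R : realType) (d K : nat).
Definition th_ (i : 'I_d) : SIdx d K := inl (inl i).
Definition p_ (i : 'I_d) : SIdx d K := inl (inr i).
Definition xi_ (k : 'I_K.+1) (i j : 'I_d) : SIdx d K := inr (k, i, j).
Definition theta_of (z : SIdx d K -> R) : 'I_d -> R := fun i => z (th_ i).
Definition is_theta (x : SIdx d K) : bool := if x is inl (inl _) then true else false.
End State.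
Arguments th_ {d K} i.
Arguments p_ {d K} i.
Arguments xi_ {d K} k i j.
Arguments theta_of {R d K} z i.
Arguments is_theta {d K} x.

Definition Amat (R : realType) (d K : nat) (Ak : 'I_K.+1 -> 'M[R]_d)
  (f : 'I_K.+1 -> ('I_d -> R) -> R) (th : 'I_d -> R) : 'M[R]_d :=
  \sum_(k < K.+1) f k th *: Ak k.

Definition generator (R : realType) (d K : nat) (pi_ : ('I_d -> R) -> R)
  (Ak : 'I_K.+1 -> 'M[R]_d) (f : 'I_K.+1 -> ('I_d -> R) -> R) (eta : 'I_K.+1 -> R)
  (phi : (SIdx d K -> R) -> R) (z : SIdx d K -> R) : R :=
  let th := theta_of z in
  let p (i : 'I_d) := z (p_ i) in
  let logpi := fun t : 'I_d -> R => ln (pi_ t) in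
  let xi (i j : 'I_d) := \sum_(k < K.+1) z (xi_ k i j) * f k th in
  \sum_(i < d) p i * partial (th_ i) phi z
  + \sum_(i < d) partial i logpi th * partial (p_ i) phi z
  - \sum_(i < d) (\sum_(j < d) xi i j * p j) * partial (p_ i) phi z
  + \sum_(i < d) \sum_(j < d) Amat Ak f th i j * partial (p_ i) (partial (p_ j) phi) z
  + \sum_(k < K.+1) f k th / eta k *
      \sum_(i < d) \sum_(j < d) (p i * p j - (i == j)%:R) * partial (xi_ k i j) phi z.

Definition nuK_density (R : realType) (d K : nat) (pi_ : ('I_d -> R) -> R)
  (Ak : 'I_K.+1 -> 'M[R]_d) (eta : 'I_K.+1 -> R) (z : SIdx d K -> R) : R :=
  pi_ (theta_of z)
  * (\prod_(i < d) ((Num.sqrt (2 * pi))^-1 * expR (- (z (p_ i) ^+ 2) / 2)))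
  * \prod_(k < K.+1) \prod_(i < d) \prod_(j < d)
      (Num.sqrt (eta k / (2 * pi)) * expR (- (eta k / 2) * (z (xi_ k i j) - Ak k i j) ^+ 2)).

(* Main.v *)
(* Write [rho] for the density of [nu_K]. Its logarithmic derivatives are
   [partial_i log pi] in [theta_i], [- p_i] in [p_i] and
   [- eta_k ([xi_k]_ij - [A^k]_ij)] in [[xi_k]_ij]. Integrating by parts one
   coordinate at a time writes [(L phi) rho] as a sum of total derivatives plus
   [phi rho] times a polynomial in [p] and [xi]: the [theta]-drift cancels the
   force, and the friction and diffusion terms leave
   [sum_ij (p_i p_j - delta_ij) (xi(theta)_ij - A(theta)_ij)], which is exactly
   what the [xi]-equations remove because [A = sum_k f_k A^k].
   A total derivative in the coordinate [x] is integrated away without Fubini: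
   differentiation under the integral sign commutes it with the coordinates
   integrated before [x], and the fundamental theorem of calculus kills it at
   [x]. *)
Require Import Defs.
From HB Require Import structures.
From mathcomp Require Import all_boot all_order all_algebra.
From mathcomp Require Import all_classical all_reals all_analysis.
From mathcomp Require Import ring lra.
Set Implicit Arguments. Unset Strict Implicit. Unset Printing Implicit Defensive.
Import Order.TTheory GRing.Theory Num.Theory.
Import numFieldNormedType.Exports.
Local Open Scope ring_scope.

(** * Functions of finitely many real variables *)

Section Update.
Context {R : realType} {I : finType}.
Implicit Types (z w : I -> R) (i j : I).

Lemma update_id z i : update z i (z i) = z.
Proof. by apply/funext => j; rewrite /update; case: eqP => [->|]. Qed.

Lemma update_eq z i t : update z i t i = t.
Proof. by rewrite /update eqxx. Qed.

Lemma update_neq z i j t : j != i -> update z i t j = z j.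
Proof. by rewrite /update => /negbTE->. Qed.

Lemma update_update z i s t : update (update z i s) i t = update z i t.
Proof. by apply/funext => j; rewrite /update; case: eqP. Qed.

Lemma updateC z i j s t : i != j ->
  update (update z i s) j t = update (update z j t) i s.
Proof.
move=> ij; apply/funext => k; rewrite /update.
by have [->|//] := eqVneq k j; rewrite eq_sym (negbTE ij).
Qed.

End Update.

Section Continuity.
Context {R : realType} {I : finType}.
Implicit Types (z w : I -> R) (i j : I) (F G : (I -> R) -> R).

Lemma contR_continuous F z i : contR F -> continuous (fun t => F (update z i t)).
Proof.
move=> cF t; apply/cvgrPdist_lt => e e0.
have [dl dl0 H] := cF (update z i t) e e0.
exists dl => //= s /= ts; rewrite distrC; apply: H => j.
have [->|ji] := eqVneq j i; first by rewrite !update_eq distrC.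
by rewrite !update_neq// subrr normr0.
Qed.

Lemma contR_cst (c : R) : contR (fun _ : I -> R => c).
Proof. by move=> z e e0; exists 1 => // w _; rewrite subrr normr0. Qed.

Lemma contR_coord i : contR (fun z : I -> R => z i).
Proof. by move=> z e e0; exists e => // w; exact. Qed.

Lemma contR_comp1 (h : R -> R) F : continuous h -> contR F -> contR (h \o F).
Proof.
move=> ch cF z e e0.
have /cvgrPdist_lt /(_ e e0) [dl dl0 H] := ch (F z).
have [d' d'0 H'] := cF z dl dl0.
exists d' => // w /H' wz; rewrite distrC; apply: H => /=.
by rewrite distrC.
Qed.

Lemma contRD F G : contR F -> contR G -> contR (fun z => F z + G z).
Proof.
move=> cF cG z e e0; have e20 : 0 < e / 2 by rewrite divr_gt0.
have [d1 d10 H1] := cF z _ e20; have [d2 d20 H2] := cG z _ e20.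
have m1 : Num.min d1 d2 <= d1 by rewrite ge_min lexx.
have m2 : Num.min d1 d2 <= d2 by rewrite ge_min lexx orbT.
exists (Num.min d1 d2); first by rewrite lt_min d10.
move=> w wz.
have := H1 w (fun i => lt_le_trans (wz i) m1).
have := H2 w (fun i => lt_le_trans (wz i) m2).
move=> h2 h1; rewrite opprD addrACA (splitr e).
by apply: le_lt_trans (ler_normD _ _) _; rewrite ltrD.
Qed.

Lemma contRM F G : contR F -> contR G -> contR (fun z => F z * G z).
Proof.
move=> cF cG z e e0.
have C0 : 0 < `|F z| + `|G z| + 1 by rewrite ltr_wpDl// addr_ge0.
(* The cap at 1 bounds the second-order term of the expansion below by |F w - F z|, so the three
   terms add up to less than [e'] times |F z| + |G z| + 1. *)
pose e' := Num.min 1 (e / (`|F z| + `|G z| + 1)).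
have e'0 : 0 < e' by rewrite lt_min ltr01 divr_gt0.
have [d1 d10 H1] := cF z _ e'0; have [d2 d20 H2] := cG z _ e'0.
have m1 : Num.min d1 d2 <= d1 by rewrite ge_min lexx.
have m2 : Num.min d1 d2 <= d2 by rewrite ge_min lexx orbT.
exists (Num.min d1 d2); first by rewrite lt_min d10.
move=> w wz.
have h1 := H1 w (fun i => lt_le_trans (wz i) m1).
have h2 := H2 w (fun i => lt_le_trans (wz i) m2).
have -> : F w * G w - F z * G z =
  (F w - F z) * (G w - G z) + F z * (G w - G z) + (F w - F z) * G z by ring.
apply: (@lt_le_trans _ _ (e' * (`|F z| + `|G z| + 1))); last first.
  by rewrite -ler_pdivlMr// ge_min lexx orbT.
have e'1 : e' <= 1 by rewrite ge_min lexx.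
apply: le_lt_trans (ler_normD _ _) _.
apply: (@le_lt_trans _ _ (`|(F w - F z) * (G w - G z)| + `|F z * (G w - G z)|
  + `|(F w - F z) * G z|)); first by rewrite lerD2r ler_normD.
rewrite !normrM.
have := normr_ge0 (F w - F z); have := normr_ge0 (G w - G z).
have := normr_ge0 (F z); have := normr_ge0 (G z).
move: `|F z| `|G z| `|F w - F z| `|G w - G z| h1 h2 => a b c d h1 h2 b0 a0 d0 c0.
have : c * d <= c by rewrite ler_piMr// (le_trans (ltW h2)).
have : a * d <= e' * a by rewrite mulrC ler_wpM2r// ltW.
have : c * b <= e' * b by rewrite ler_wpM2r// ltW.
by lra.
Qed.

(* The constant [dl] is uniform in [t] by compactness of [`[-M, M]]. *)
Lemma contR_tube F z i (M e : R) : contR F -> 0 < e ->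
  exists2 dl : R, 0 < dl & forall w t, (forall j, j != i -> `|w j - z j| < dl) ->
    `|t| <= M -> `|F (update w i t) - F (update z i t)| < e.
Proof.
move=> cF e0; have e20 : 0 < e / 2 by rewrite divr_gt0.
pose P (dl t : R) := forall w, (forall j, j != i -> `|w j - z j| < dl) ->
  `|F (update w i t) - F (update z i t)| < e.
(* In the near-covering form of compactness the parameter is the radius, running along the filter of
   positive reals that tend to 0. *)
have /compact_near_coveringP cpt := @segment_compact R (- M) M.
have [] := cpt R (at_right (0:R)) P _.
  move=> x _.
  have [dl dl0 H] := cF (update z i x) _ e20.
  exists ((fun t : R => `|x - t| < dl : Prop), (fun d : R => 0 < d < dl : Prop)) => /=.
    split; first by exists dl.
    exists dl => //= d /=; rewrite sub0r normrN => dd d0.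
    by rewrite d0 /= (le_lt_trans (ler_norm _)).
  move=> [t d] /= [xt /andP[d0 ddl]] w wz.
  rewrite (splitr e) -(subrKA (F (update z i x))).
  apply: le_lt_trans (ler_normD _ _) _; rewrite ltrD//.
    apply: H => j; have [->|ji] := eqVneq j i; first by rewrite !update_eq distrC.
    by rewrite !update_neq// (lt_trans (wz j ji)).
  rewrite distrC; apply: H => j; have [->|ji] := eqVneq j i.
    by rewrite !update_eq distrC.
  by rewrite !update_neq// subrr normr0.
move=> r /= r0 H; have r20 : 0 < r / 2 by rewrite divr_gt0.
exists (r / 2) => // w t wz tM.
apply: (H (r / 2)) => //=.
  by rewrite sub0r normrN gtr0_norm// ltr_pdivrMr// mulr_natr mulr2n ltrDl.
by rewrite in_itv /= -ler_norml.
Qed.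

End Continuity.

(** * Integration over one coordinate *)

Section Integration.
Context {R : realType} {I : finType}.
Implicit Types (z w : I -> R) (i j x : I) (F G : (I -> R) -> R) (S : pred I).

(* [S] holds the coordinates that have not been integrated out yet. *)
Definition cont_csupp S F := contR F /\
  exists2 M : R, 0 < M & forall z j, S j -> M < `|z j| -> F z = 0.

Definition int1 i F z : R :=
  Rintegral (@lebesgue_measure R) setT (fun t => F (update z i t)).

(** The derivative is an explicit function, so that product and chain rules compute it. Continuity
    of [F] and [F'] is bundled in because the fundamental theorem of calculus and differentiation
    under the integral both rely on it. *)
Definition has_partial x F F' := [/\ contR F, contR F' &
  forall z, is_derive (z x) 1 (fun t => F (update z x t)) (F' z)].

(** [has_partial] differentiates only at the coordinate of the base point; moving the base point
    along the line gives the derivative at every [t]. *)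
Lemma has_partialP {x F F'} : has_partial x F F' ->
  forall z (t : R), is_derive t 1 (fun s => F (update z x s)) (F' (update z x t)).
Proof.
move=> [_ _ H] z t; have := H (update z x t); rewrite update_eq.
by under eq_fun do rewrite update_update.
Qed.

Lemma continuous_integrable_restrict (g : R -> R) (a b : R) : continuous g ->
  (@lebesgue_measure R).-integrable setT (EFin \o (g \_ (`[a, b]%classic : set R))).
Proof.
move=> cg; rewrite -restrict_EFin.
rewrite -integrable_mkcond; last exact: measurable_itv.
apply: continuous_compact_integrable; first exact: segment_compact.
exact: continuous_subspaceT.
Qed.

Lemma cont_csupp_integrable S F i z : cont_csupp S F -> S i ->
  (@lebesgue_measure R).-integrable setT (EFin \o (fun t => F (update z i t))).
Proof.
move=> [cF [M M0 HM]] Si.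
have E : (fun t => F (update z i t)) =
         (fun t : R => F (update z i t)) \_ (`[- M, M]%classic : set R).
  apply/funext => t; rewrite patchE; case: ifPn => //.
  rewrite notin_setE /= in_itv /= -ler_norml => /negP; rewrite -ltNge => tM.
  by apply: (HM _ i Si); rewrite update_eq.
by rewrite E; apply: continuous_integrable_restrict; exact: contR_continuous.
Qed.

Lemma int1E i F z M : (forall t, M < `|t| -> F (update z i t) = 0) ->
  int1 i F z =
    Rintegral (@lebesgue_measure R) `[- M, M]%classic (fun t => F (update z i t)).
Proof.
move=> H; rewrite Rintegral_mkcond; apply: eq_Rintegral => t _.
rewrite patchE; case: ifPn => //.
by rewrite notin_setE /= in_itv /= -ler_norml => /negP; rewrite -ltNge => /H.
Qed.

Lemma int1D S F G i z : cont_csupp S F -> cont_csupp S G -> S i ->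
  int1 i (fun z => F z + G z) z = int1 i F z + int1 i G z.
Proof. by move=> cF cG Si; apply: RintegralD => //; exact: (@cont_csupp_integrable S). Qed.

(** The support bound survives because updating [i] leaves the other coordinates alone. Continuity
    follows from the estimate of [contR_tube], uniform on the segment that carries the integrand. *)
Lemma cont_csupp_int1 S F i : cont_csupp S F -> S i ->
  cont_csupp (predD1 S i) (int1 i F).
Proof.
move=> CF Si; have [cF [M M0 HM]] := CF; split; last first.
  exists M => // z j /andP[/= ji Sj] Mz; rewrite /int1.
  rewrite (_ : (fun t => _) = fun=> 0); first by rewrite /Rintegral integral0.
  by apply/funext => t; apply: (HM _ j Sj); rewrite update_neq.
move=> z e e0.
(* The segment has length 2M; dividing by 2M + 1 keeps the final bound strictly below [e]. *)
have e'0 : 0 < e / (2 * M + 1).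
  by rewrite divr_gt0 // ltr_wpDl// mulr_ge0 // ltW.
have [dl dl0 H] := contR_tube z i M cF e'0.
exists dl => // w wz.
have HM0 v t : M < `|t| -> F (update v i t) = 0.
  by move=> tM; apply: (HM _ i Si); rewrite update_eq.
have itg v : (@lebesgue_measure R).-integrable `[- M, M]%classic
    (EFin \o (fun t => F (update v i t))).
  by apply: integrableS (cont_csupp_integrable v CF Si).
have itB : (@lebesgue_measure R).-integrable `[- M, M]%classic
    (EFin \o (fun t => F (update w i t) - F (update z i t))).
  by apply: (integrableB _ (itg w) (itg z)).
rewrite !(int1E (HM0 _)) -RintegralB//.
apply: le_lt_trans (le_normr_Rintegral _ _) _ => //.
apply: (@le_lt_trans _ _ (e / (2 * M + 1) * (2 * M))).
  have mm : lebesgue_measure `[- M, M]%classic = (2 * M)%:E.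
    rewrite lebesgue_measure_itv /= lte_fin ifT ?gtrN//.
    by rewrite -EFinB; congr EFin; ring.
  have -> : e / (2 * M + 1) * (2 * M) =
    Rintegral (@lebesgue_measure R) `[- M, M]%classic (fun=> e / (2 * M + 1)).
    rewrite Rintegral_cst//; congr (_ * _); exact: (esym (congr1 fine mm)).
  apply: le_Rintegral => //.
  - by apply: integrable_norm; exact: itB.
  - apply/integrableP; split; first exact: measurable_cst.
    rewrite integral_cst//= [lebesgue_measure _]mm -EFinM; exact: ltry.
  - move=> t /=; rewrite in_itv /= -ler_norml => tM.
    by apply: ltW; apply: H.
rewrite mulrAC ltr_pdivrMr; last by rewrite ltr_wpDl// mulr_ge0 // ltW.
by rewrite ltr_pM2l// ltrDl.
Qed.

(** Differentiation under the integral sign, with a dominating function read off from [F'] at the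
    base point. *)
Lemma has_partial_int1 S F F' x i : has_partial x F F' ->
  cont_csupp S F -> cont_csupp S F' -> S i -> x != i -> has_partial x (int1 i F) (int1 i F').
Proof.
move=> pF CF CF' Si xi; have [cF cF' dF] := pF.
split; [by have [] := cont_csupp_int1 CF Si|by have [] := cont_csupp_int1 CF' Si|move=> z].
have [_ [M M0 HM]] := CF'.
have [dl dl0 H] := contR_tube z i M cF' (@ltr01 R).
pose f (s t : R) := F (update (update z i t) x s).
have fE s t : f s t = F (update (update z x s) i t) by rewrite /f updateC// eq_sym.
(* For [s] within [dl] of [z x], the derivative differs by less than 1 from its value at [z] when
   |t| <= M, and it vanishes when |t| > M. Hence [G] dominates. *)
pose G := (fun t => `|F' (update z i t)| + 1) \_ (`[- M, M]%classic).
have dE s t : derive1 (f ^~ t) s = F' (update (update z x s) i t).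
  rewrite derive1E; have := has_partialP pF (update z i t) s => -[_ ->].
  by rewrite updateC// eq_sym.
have intf s : `](z x - dl), (z x + dl)[%classic s ->
    (@lebesgue_measure R).-integrable setT (EFin \o f s).
  move=> _; rewrite (_ : f s = fun t => F (update (update z x s) i t)).
    exact: cont_csupp_integrable CF Si.
  by apply/funext => t; exact: fE.
have df (s t : R) : `](z x - dl), (z x + dl)[%classic s -> [set: R]%classic t ->
    derivable (f ^~ t) s 1.
  by move=> _ _; have := has_partialP pF (update z i t) s => -[].
have G0 t : 0 <= G t.
  by rewrite /G patchE; case: ifP => // _; rewrite addr_ge0.
have iG : (@lebesgue_measure R).-integrable setT (EFin \o G).
  apply: continuous_integrable_restrict => t; apply: cvgD; last exact: cvg_cst.
  by apply: cvg_norm; exact: contR_continuous.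
have Gub (s t : R) : `](z x - dl), (z x + dl)[%classic s -> [set: R]%classic t ->
    `|partial1of2 f s t| <= G t.
  rewrite /= in_itv /= => zs _; rewrite /partial1of2 dE /G patchE.
  case: ifPn => [|].
    rewrite mem_setE /= in_itv /= -ler_norml => tM.
    rewrite -(subrK (F' (update z i t)) (F' _)) addrC.
    apply: le_trans (ler_normD _ _) _; rewrite lerD2l; apply: ltW.
    apply: H => // j ji; have [->|jx] := eqVneq j x.
      by rewrite update_eq ltr_distlC; lra.
    by rewrite update_neq// subrr normr0.
  rewrite notin_setE /= in_itv /= -ler_norml => /negP; rewrite -ltNge => tM.
  by rewrite (HM _ i Si) ?normr0// update_eq.
have zI : `](z x - dl), (z x + dl)[%classic (z x) by rewrite /= in_itv /=; lra.
have D1 := derivable_under_integral measurableT zI intf df G0 iG Gub.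
have D2 := differentiation_under_integral measurableT zI intf df G0 iG Gub.
have E : (fun s => int1 i F (update z x s)) =
   (fun s => Rintegral (@lebesgue_measure R) setT (f s)).
  by apply/funext => s; apply: eq_Rintegral => t _; exact: (esym (fE s t)).
rewrite E; split; first exact: D1.
rewrite -derive1E D2; apply: eq_Rintegral => t _.
by rewrite /partial1of2 dE update_id.
Qed.

Lemma int1_partial S F F' x z : has_partial x F F' ->
  cont_csupp S F -> cont_csupp S F' -> S x ->
  int1 x F' z = 0.
Proof.
move=> pF [cF [M M0 HM]] [cF' [M' M'0 HM']] Sx.
(* The added 1 puts both endpoints strictly outside the supports, where [F] is known to vanish; the
   boundary terms are then zero. *)
pose N := Num.max M M' + 1.
have N0 : 0 < N by rewrite ltr_wpDl// le_max ltW.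
have MN : M < N by rewrite ltr_pwDr// le_max lexx.
have M'N : M' < N by rewrite ltr_pwDr// le_max lexx orbT.
rewrite (@int1E x _ _ N); last first.
  by move=> t Nt; apply: (HM' _ x Sx); rewrite update_eq (lt_trans M'N).
rewrite /Rintegral (@continuous_FTC2 _ _ (fun t => F (update z x t))).
- rewrite !(HM _ x Sx) ?update_eq ?normrN ?(gtr0_norm N0)//.
  by rewrite subee.
- by rewrite gtrN.
- by apply: continuous_subspaceT; exact: contR_continuous.
- split.
  + by move=> t _; have [] := has_partialP pF z t.
  + by apply: cvg_at_right_filter; exact: contR_continuous.
  + by apply: cvg_at_left_filter; exact: contR_continuous.
- by move=> t _; rewrite derive1E; have [_ ->] := has_partialP pF z t.
Qed.

End Integration.

(** * Iterated integrals and total derivatives *)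

Section Closure.
Context {R : realType} {I : finType}.
Implicit Types (z w : I -> R) (i j x : I) (F G : (I -> R) -> R) (S : pred I).

Lemma cont_csupp_sub S S' F : (forall x, S' x -> S x) ->
  cont_csupp S F -> cont_csupp S' F.
Proof.
by move=> SS [cF [M M0 HM]]; split=> //; exists M => // z j /SS; exact: HM.
Qed.

Lemma cont_csupp0 S : cont_csupp S (fun _ : I -> R => 0).
Proof. by split; [exact: contR_cst|exists 1]. Qed.

Lemma cont_csuppD S F G : cont_csupp S F -> cont_csupp S G ->
  cont_csupp S (fun z => F z + G z).
Proof.
move=> [cF [M M0 HM]] [cG [N N0 HN]]; split; first exact: contRD.
exists (Num.max M N); first by rewrite lt_max M0.
by move=> z j Sj; rewrite gt_max => /andP[/(HM _ _ Sj)-> /(HN _ _ Sj)->]; rewrite addr0.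
Qed.

Lemma cont_csuppM S F G : contR F -> cont_csupp S G ->
  cont_csupp S (fun z => F z * G z).
Proof.
move=> cF [cG [N N0 HN]]; split; first exact: contRM.
by exists N => // z j Sj /(HN _ _ Sj)->; rewrite mulr0.
Qed.

Lemma cont_csupp_iint F s : cont_csupp predT F -> uniq s ->
  cont_csupp [pred x | x \notin s] (iint s F).
Proof.
move=> CF; elim: s => [|i s IHs] /=; first by move=> _; apply: (cont_csupp_sub _ CF).
move=> /andP[si /IHs Cs]; apply: (@cont_csupp_sub (predD1 [pred x | x \notin s] i)).
  by move=> x /=; rewrite inE negb_or.
exact: cont_csupp_int1.
Qed.

Lemma iintD F G s z : cont_csupp predT F -> cont_csupp predT G -> uniq s ->
  iint s (fun z => F z + G z) z = iint s F z + iint s G z.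
Proof.
move=> CF CG; elim: s z => [|i s IHs] z //= /andP[si us].
rewrite -(@int1D _ _ [pred x | x \notin s] (iint s F) (iint s G))//;
  try exact: cont_csupp_iint.
by apply: eq_Rintegral => t _; rewrite IHs.
Qed.

Lemma iint0 s z : iint s (fun _ : I -> R => 0) z = 0.
Proof.
elim: s z => [|i s IHs] z //=; under eq_Rintegral do rewrite IHs.
by rewrite /Rintegral integral0.
Qed.

Lemma has_partial_iint F F' x s : has_partial x F F' -> cont_csupp predT F ->
  cont_csupp predT F' -> uniq s -> x \notin s -> has_partial x (iint s F) (iint s F').
Proof.
move=> pF CF CF'; elim: s => [|i s IHs] //= /andP[si us].
rewrite inE negb_or => /andP[xi xs].
apply: (@has_partial_int1 _ _ [pred x | x \notin s]) => //; first exact: IHs.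
  exact: cont_csupp_iint.
exact: cont_csupp_iint.
Qed.

(** The head of the list is the outermost integral. The coordinates after [x] are therefore
    integrated first, and [has_partial_iint] still leaves a derivative in [x]; the coordinates
    before [x] only integrate zero. *)
Lemma iint_partial F F' x s z : has_partial x F F' -> cont_csupp predT F ->
  cont_csupp predT F' -> uniq s -> x \in s -> iint s F' z = 0.
Proof.
move=> pF CF CF'; elim: s z => [|i s IHs] z //= /andP[si us].
rewrite inE; have [xi|xi /= xs] := eqVneq x i.
  rewrite -{}xi in si * => _; apply: (@int1_partial _ _ [pred x | x \notin s] (iint s F)) => //;
    try exact: cont_csupp_iint.
  exact: has_partial_iint.
under eq_Rintegral do rewrite IHs//.
by rewrite /Rintegral integral0.
Qed.

(** The support condition is kept along with the zero integral because additivity of [iint] needs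
    integrable summands. *)
Definition null_integral F := cont_csupp predT F /\ integral_Rn F = 0.

Lemma null_integralD F G : null_integral F -> null_integral G ->
  null_integral (fun z => F z + G z).
Proof.
move=> [CF F0] [CG G0]; split; first exact: cont_csuppD.
by rewrite /integral_Rn iintD ?enum_uniq// [iint _ F _]F0 [iint _ G _]G0 addr0.
Qed.

Lemma null_integral_sum (J : finType) (F : J -> (I -> R) -> R) :
  (forall k, null_integral (F k)) -> null_integral (fun z => \sum_k F k z).
Proof.
move=> H; elim: (index_enum J) => [|k s IHs].
  under eq_fun do rewrite big_nil.
  by split; [exact: cont_csupp0|exact: iint0].
by under eq_fun do rewrite big_cons; exact: null_integralD.
Qed.

(** * Rules of differentiation and integration by parts *)

Lemma has_partial_cst x (c : R) : has_partial x (fun _ : I -> R => c) (fun=> 0).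
Proof. by split; [exact: contR_cst|exact: contR_cst|move=> z; exact: is_derive_cst]. Qed.

Lemma has_partial_indep x F : contR F -> (forall z t, F (update z x t) = F z) ->
  has_partial x F (fun=> 0).
Proof.
move=> cF H; split=> //; first exact: contR_cst.
by move=> z; under eq_fun do rewrite H; exact: is_derive_cst.
Qed.

Lemma has_partial_coord x y : has_partial x (fun z : I -> R => z y) (fun=> (y == x)%:R).
Proof.
split; [exact: contR_coord|exact: contR_cst|move=> z].
have [->|yx] := eqVneq y x.
  by under eq_fun do rewrite update_eq; exact: is_derive_id.
by under eq_fun do rewrite update_neq//; exact: is_derive_cst.
Qed.

Lemma has_partialD x F F' G G' : has_partial x F F' -> has_partial x G G' ->
  has_partial x (fun z => F z + G z) (fun z => F' z + G' z).
Proof.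
move=> [cF cF' dF] [cG cG' dG]; split; [exact: contRD|exact: contRD|move=> z].
by have := is_deriveD (dF z) (dG z).
Qed.

Lemma has_partialM x F F' G G' : has_partial x F F' -> has_partial x G G' ->
  has_partial x (fun z => F z * G z) (fun z => F z * G' z + F' z * G z).
Proof.
move=> [cF cF' dF] [cG cG' dG]; split; first exact: contRM.
  by apply: contRD; exact: contRM.
move=> z; have /is_derive_eq := is_deriveM (dF z) (dG z); apply.
by rewrite update_id /GRing.scale /= [G z * _]mulrC.
Qed.

Lemma has_partial_comp x F F' (h h' : R -> R) : has_partial x F F' ->
  (forall t : R, is_derive t 1 h (h' t)) -> continuous h' ->
  has_partial x (fun z => h (F z)) (fun z => h' (F z) * F' z).
Proof.
move=> [cF cF' dF] dh ch'; split.
- apply: (contR_comp1 _ cF) => t; apply: differentiable_continuous.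
  by apply/derivable1_diffP; have [] := dh t.
- by apply: contRM => //; exact: (contR_comp1 ch' cF).
- move=> z; have := is_derive1_comp (dh (F (update z x (z x)))) (dF z).
  by rewrite update_id.
Qed.

Lemma has_partial_eq x F F' G G' : F =1 G -> F' =1 G' ->
  has_partial x F F' -> has_partial x G G'.
Proof. by move=> /funext-> /funext->. Qed.

(** Each [h k] is the logarithmic derivative of [g k], and logarithmic derivatives of a product add
    up. Stating this multiplicatively avoids any division. *)
Lemma has_partial_prod (J : finType) (P : pred J) (g h : J -> (I -> R) -> R) x :
  (forall k, P k -> has_partial x (g k) (fun z => h k z * g k z)) ->
  has_partial x (fun z => \prod_(k | P k) g k z)
    (fun z => (\sum_(k | P k) h k z) * \prod_(k | P k) g k z).
Proof.
move=> H; elim: (index_enum J) => [|k s IHs].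
  apply: has_partial_eq (has_partial_cst x 1) => z; rewrite !big_nil//.
  by rewrite mul0r.
have [Pk|Pk] := boolP (P k); last first.
  by apply: has_partial_eq IHs => z; rewrite !big_cons (negbTE Pk).
apply: has_partial_eq (has_partialM (H k Pk) IHs) => z; rewrite !big_cons Pk//.
by ring.
Qed.

Lemma has_partial_sum (J : finType) (F F' : J -> (I -> R) -> R) x :
  (forall k, has_partial x (F k) (F' k)) ->
  has_partial x (fun z => \sum_k F k z) (fun z => \sum_k F' k z).
Proof.
move=> H; elim: (index_enum J) => [|k s IHs].
  by apply: has_partial_eq (has_partial_cst x 0) => z; rewrite big_nil.
by apply: has_partial_eq (has_partialD (H k) IHs) => z; rewrite big_cons.
Qed.

(** The integrand is the derivative of [a * F] in [x]. Only [F] has to be compactly supported, so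
    [a] may contain the density and unbounded coefficients. *)
Lemma null_integral_partialM x a a' F F' : has_partial x a a' ->
  has_partial x F F' -> cont_csupp predT F -> cont_csupp predT F' ->
  null_integral (fun z => a z * F' z + a' z * F z).
Proof.
move=> pa pF CF CF'; have [ca ca' _] := pa.
have CM : cont_csupp predT (fun z => a z * F' z + a' z * F z).
  by apply: cont_csuppD; exact: cont_csuppM.
split=> //; apply: (iint_partial _ (has_partialM pa pF)) => //.
- exact: cont_csuppM.
- exact: enum_uniq.
- by rewrite mem_enum.
Qed.

(** * Smooth functions and compact supports *)

Lemma smooth_contR F : smooth F -> contR F.
Proof. by move=> /(_ 0%N)[]. Qed.

Lemma smooth_partial F x : smooth F -> smooth (partial x F).
Proof. by move=> sF k; have [_ [_]] := sF k.+1; exact. Qed.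

Lemma smooth_has_partial F x : smooth F -> has_partial x F (partial x F).
Proof.
move=> sF; split; [exact: smooth_contR|exact/smooth_contR/smooth_partial|move=> z].
have [_ [dF _]] := sF 1%N; split; first exact: dF.
by rewrite /partial derive1E.
Qed.

Lemma compact_support_partial F x : compact_support F -> compact_support (partial x F).
Proof.
move=> [M HM]; exists M => z [j Mz]; rewrite /partial derive1E.
(* [F] is zero near the point on the line: either the large coordinate is not the one that moves, or
   it stays above [M] in modulus by continuity. *)
rewrite (@near_eq_derive _ _ _ _ (cst 0)) ?derive_cst//.
have [jx|jx] := eqVneq j x; last first.
  by near=> t; apply: HM; exists j; rewrite update_neq.
rewrite jx in Mz; near=> t; apply: HM; exists x; rewrite update_eq.
near: t; apply: (cvgr_gt `|z x|) => //; exact: cvg_norm.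
Unshelve. all: end_near. Qed.

Lemma compact_support_cont_csupp F : contR F -> compact_support F -> cont_csupp predT F.
Proof.
(* The bound given by [compact_support] may be nonpositive, while [cont_csupp] asks for a positive
   one. *)
move=> cF [M HM]; split=> //; exists (Num.max M 1); first by rewrite lt_max ltr01 orbT.
by move=> z j _; rewrite gt_max => /andP[Mz _]; apply: HM; exists j.
Qed.

End Closure.

(** * The density *)

(** The prefactor [c] is general so that the induction can absorb [g y (z y)] into it: this factor
    is constant for the inner integrals since [y] does not occur in the tail. *)
Lemma eiint_prod (R : realType) (I : finType) (g : I -> R -> R) (s : seq I)
    (c : (I -> R) -> R) (z : I -> R) : uniq s ->
  (forall y, y \in s -> [/\ measurable_fun setT (g y), forall t, 0 <= g y t &
    (\int[@lebesgue_measure R]_t (g y t)%:E = 1)%E]) ->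
  (forall z, 0 <= c z) ->
  (forall z y t, y \in s -> c (update z y t) = c z) ->
  eiint s (fun z => c z * \prod_(y <- s) g y (z y)) z = (c z)%:E.
Proof.
elim: s c z => [|y s IHs] c z /=; first by rewrite big_nil mulr1.
move=> /andP[ys us] Hg c0 Hc.
have [mg g0 ig] := Hg y (mem_head _ _).
have E t : eiint s (fun z => c z * \prod_(j <- y :: s) g j (z j)) (update z y t) =
    (c z * g y t)%:E.
  under eq_fun do rewrite big_cons mulrA.
  rewrite (IHs (fun z => c z * g y (z y))) //.
  - by rewrite Hc ?mem_head// update_eq.
  - by move=> j js; apply: Hg; rewrite inE js orbT.
  - by move=> w; rewrite mulr_ge0.
  - move=> w j r js; rewrite Hc ?inE ?js ?orbT// update_neq//.
    by apply: contraNneq ys => ->.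
under eq_integral do rewrite E EFinM.
rewrite ge0_integralZl_EFin ?ig ?mule1//.
- by move=> t _; rewrite lee_fin.
- exact/measurable_realfun.measurable_EFinP.
Qed.

Section State.
Context {R : realType} {d K : nat}.
Local Notation SI := (SIdx d K).

Lemma theta_of_update (z : SI -> R) x t : ~~ is_theta x ->
  theta_of (update z x t) = theta_of z.
Proof.
move=> xth; apply/funext => i; rewrite /theta_of update_neq//.
by apply: contraNneq xth => <-.
Qed.

Lemma contR_theta (G : ('I_d -> R) -> R) :
  contR G -> contR (fun z : SI -> R => G (theta_of z)).
Proof.
move=> cG z e e0; have [dl dl0 H] := cG (theta_of z) e e0.
by exists dl => // w wz; apply: H => i; exact: wz.
Qed.

Lemma has_partial_theta (G : ('I_d -> R) -> R) i : smooth G ->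
  has_partial (th_ i) (fun z : SI -> R => G (theta_of z))
    (fun z => partial i G (theta_of z)).
Proof.
move=> sG; have [cG cG' dG] := smooth_has_partial i sG.
(* Restricting an update in [th_ i] to the position block is, by computation, the update in [i] of
   the restriction. *)
by split=> [||z]; [exact: contR_theta|exact: contR_theta|exact: dG].
Qed.

Lemma has_partial_theta_indep (G : ('I_d -> R) -> R) x : contR G -> ~~ is_theta x ->
  has_partial x (fun z : SI -> R => G (theta_of z)) (fun=> 0).
Proof.
move=> cG xth; apply: has_partial_indep; first exact: contR_theta.
by move=> z t; rewrite theta_of_update.
Qed.

(** The factor [(y == x)%:R] treats all coordinates at once, and the logarithmic form fits
    [has_partial_prod]. *)
Lemma has_partial_gauss (I : finType) (x y : I) (b c m : R) :
  has_partial x (fun z => c * expR (b * (z y - m) ^+ 2))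
    (fun z => ((y == x)%:R * (2 * b * (z y - m))) * (c * expR (b * (z y - m) ^+ 2))).
Proof.
have h1 := has_partialD (has_partial_coord x y) (has_partial_cst x (- m)).
have h2 := has_partialM (has_partial_cst x b) (has_partialM h1 h1).
have h3 := has_partial_comp h2 (@is_derive_expR R) (@continuous_expR R).
apply: has_partial_eq (has_partialM (has_partial_cst x c) h3) => z //=.
by ring.
Qed.

Variables (pi_ : ('I_d -> R) -> R)
  (Ak : 'I_K.+1 -> 'M[R]_d) (eta : 'I_K.+1 -> R).

(** The value 1 on position coordinates is a placeholder: products of marginals range over the other
    coordinates only. *)
Definition marginal (x : SI) (t : R) : R :=
  match x with
  | inl (inl _) => 1
  | inl (inr _) => (Num.sqrt (2 * pi))^-1 * expR (- (t ^+ 2) / 2)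
  | inr (k, i, j) =>
      Num.sqrt (eta k / (2 * pi)) * expR (- (eta k / 2) * (t - Ak k i j) ^+ 2)
  end.

Lemma nuK_densityE z : nuK_density pi_ Ak eta z =
  pi_ (theta_of z) * \prod_(x | ~~ is_theta x) marginal x (z x).
Proof.
rewrite /nuK_density -mulrA; congr (_ * _).
rewrite big_sumType big_sumType /=.
rewrite [X in _ = X * _ * _]big_pred0 // mul1r; congr (_ * _).
by rewrite !pair_bigA /=; apply: eq_bigr => -[[k i] j].
Qed.

(** Recognising normal densities gives measurability, nonnegativity and total mass 1 at once. *)
Lemma marginal_normal : (forall k, 0 < eta k) ->
  forall x : SI, ~~ is_theta x -> exists m s, marginal x = normal_pdf m s.
Proof.
move=> eta0 [[//|i]|[[k i] j]] _.
  exists 0, 1; apply/funext => t; rewrite normal_pdfE ?oner_eq0//.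
  by rewrite /normal_peak /normal_fun /= subr0 expr1n mul1r mulr_natl.
(* The variance is the inverse of [eta k]. *)
exists (Ak k i j), (Num.sqrt (eta k))^-1; apply/funext => t.
have e0 := eta0 k.
rewrite normal_pdfE ?invr_neq0 ?gt_eqF ?sqrtr_gt0//.
rewrite /normal_peak /normal_fun /= exprVn sqr_sqrtr ?ltW//; congr (_ * expR _).
  rewrite -sqrtrV; last by rewrite mulrn_wge0// mulr_ge0 ?invr_ge0 ?pi_ge0 ?ltW.
  congr Num.sqrt; rewrite -mulr_natl; have := pi_gt0 R; move: (pi : R) => q q0.
  by field; rewrite !gt_eqF.
by field; rewrite gt_eqF.
Qed.

Lemma eiint_nuK_density z : (forall th, 0 < pi_ th) -> (forall k, 0 < eta k) ->
  eiint [seq x <- enum SI | ~~ is_theta x] (nuK_density pi_ Ak eta) z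
  = (pi_ (theta_of z))%:E.
Proof.
move=> pi0 eta0.
rewrite (_ : nuK_density _ _ _ = fun z => pi_ (theta_of z) *
  \prod_(x <- [seq x <- enum SI | ~~ is_theta x]) marginal x (z x)); last first.
  by apply/funext => w; rewrite nuK_densityE big_filter big_enum_cond.
rewrite (@eiint_prod _ _ marginal _ (fun z => pi_ (theta_of z)))//.
- by rewrite filter_uniq// enum_uniq.
- move=> x; rewrite mem_filter => /andP[/(marginal_normal eta0)[m [s ->]] _].
  split; [exact: measurable_normal_pdf|exact: normal_pdf_ge0|].
  exact: integral_normal_pdf.
- by move=> w; exact: ltW.
- by move=> w x t; rewrite mem_filter => /andP[xth _]; rewrite theta_of_update.
Qed.

(** The gradient of the logarithm of the density, coordinate by coordinate. *)
Definition score (x : SI) (z : SI -> R) : R :=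
  match x with
  | inl (inl i) => partial i (fun th => ln (pi_ th)) (theta_of z)
  | inl (inr i) => - z (p_ i)
  | inr (k, i, j) => - (eta k * (z (xi_ k i j) - Ak k i j))
  end.

Hypothesis pi0 : forall th, 0 < pi_ th.
Hypothesis slogpi : smooth (fun th => ln (pi_ th)).

(** Every factor differentiates to itself times its logarithmic derivative. For the position factor
    this comes from writing it as the exponential of its logarithm; in the Gaussian product only the
    term of [x] itself survives. *)
Lemma has_partial_density x :
  has_partial x (nuK_density pi_ Ak eta)
    (fun z => score x z * nuK_density pi_ Ak eta z).
Proof.
have Hm y : ~~ is_theta y -> has_partial x (fun z => marginal y (z y))
    (fun z => ((y == x)%:R * score y z) * marginal y (z y)).
  case: y => [[//|i]|[[k i] j]] _ /=.
    have H := has_partial_gauss x (@p_ d K i) (- 2^-1) (Num.sqrt (2 * pi))^-1 0.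
    apply: has_partial_eq H => z.
      by congr (_ * expR _); field.
    by congr (_ * _ * (_ * expR _)); field.
  have H := has_partial_gauss x (xi_ k i j) (- (eta k / 2))
    (Num.sqrt (eta k / (2 * pi))) (Ak k i j).
  apply: has_partial_eq H => z //=.
  by congr (_ * _ * _); field.
have Hp := has_partial_prod Hm.
have Hpi : has_partial x (fun z : SI -> R => pi_ (theta_of z))
    (fun z => (if is_theta x then score x z else 0) * pi_ (theta_of z)).
  have piE th : expR (ln (pi_ th)) = pi_ th by rewrite lnK// posrE.
  have H : has_partial x (fun z : SI -> R => ln (pi_ (theta_of z)))
      (fun z => if is_theta x then score x z else 0).
    move: x {Hm Hp} => [[i|i]|[[k i] j]] /=.
    - exact: (has_partial_theta i slogpi).
    - apply: (@has_partial_theta_indep (fun th => ln (pi_ th))) => //; exact: smooth_contR.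
    - apply: (@has_partial_theta_indep (fun th => ln (pi_ th))) => //; exact: smooth_contR.
  apply: has_partial_eq (has_partial_comp H (@is_derive_expR R) (@continuous_expR R)) => z /=.
    by rewrite piE.
  by rewrite piE mulrC.
apply: has_partial_eq (has_partialM Hpi Hp) => z; rewrite nuK_densityE//.
rewrite mulrCA -mulrA -mulrDl; congr (_ * _).
have [xth|xth] := boolP (is_theta x).
  rewrite big1 ?add0r// => y yth; rewrite (_ : y == x = false) ?mul0r//.
  by apply: contraNF yth => /eqP->.
rewrite addr0 (bigD1 x)//= eqxx mul1r big1 ?addr0// => y /andP[_ /negbTE->].
by rewrite mul0r.
Qed.

End State.

(** * Invariance *)

Section Invariance.
Context {R : realType} {d K : nat} (pi_ : ('I_d -> R) -> R)
  (f : 'I_K.+1 -> ('I_d -> R) -> R) (Ak : 'I_K.+1 -> 'M[R]_d) (eta : 'I_K.+1 -> R).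
Hypothesis pi0 : forall th, 0 < pi_ th.
Hypothesis slogpi : smooth (fun th => ln (pi_ th)).
Hypothesis sf : forall k, smooth (f k).
Hypothesis eta0 : forall k, 0 < eta k.

Local Notation rho := (nuK_density pi_ Ak eta).
Local Notation sc x := (score pi_ Ak eta x).

Lemma null_integral_generator phi : smooth phi -> compact_support phi ->
  null_integral (fun z => generator pi_ Ak f eta phi z * rho z).
Proof.
move=> sphi cphi.
have CCphi : cont_csupp predT phi.
  by apply: compact_support_cont_csupp => //; exact: smooth_contR.
have CCdphi x : cont_csupp predT (partial x phi).
  apply: compact_support_cont_csupp; first exact/smooth_contR/smooth_partial.
  exact: compact_support_partial.
have CCddphi x y : cont_csupp predT (partial x (partial y phi)).
  apply: compact_support_cont_csupp; first exact/smooth_contR/smooth_partial/smooth_partial.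
  exact/compact_support_partial/compact_support_partial.
have dphi x := smooth_has_partial x sphi.
have ddphi x y := smooth_has_partial x (smooth_partial y sphi).
have drho x := has_partial_density Ak eta pi0 slogpi x.
have df k (x : SIdx d K) : ~~ is_theta x ->
    has_partial x (fun z => f k (theta_of z)) (fun=> 0).
  by apply: has_partial_theta_indep; exact: smooth_contR.
have dA i j (x : SIdx d K) : ~~ is_theta x ->
    has_partial x (fun z => Amat Ak f (theta_of z) i j) (fun=> 0).
  move=> xth; have H k := has_partialM (df k x xth) (has_partial_cst x (Ak k i j)).
  apply: has_partial_eq (has_partial_sum H) => z /=.
    by rewrite /Amat summxE; apply: eq_bigr => k _; rewrite mxE.
  by rewrite big1// => k _; rewrite mulr0 mul0r addr0.
have dp i x := @has_partial_coord R _ x (@p_ d K i).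
pose ds (i : 'I_d) (th : 'I_d -> R) := partial i (fun th => ln (pi_ th)) th.
have dds i (x : SIdx d K) : ~~ is_theta x ->
    has_partial x (fun z => ds i (theta_of z)) (fun=> 0).
  by apply: has_partial_theta_indep; exact/smooth_contR/smooth_partial.
pose xi (z : SIdx d K -> R) i j := \sum_k z (xi_ k i j) * f k (theta_of z).
have dxi i j l : has_partial (p_ l) (fun z => xi z i j) (fun=> 0).
  have H k := has_partialM (has_partial_coord (p_ l) (@xi_ d K k i j))
    (df k (p_ l) isT).
  apply: has_partial_eq (has_partial_sum H) => z //=.
  by rewrite big1// => k _; rewrite mulr0 mul0r addr0.
have pE i j : (p_ j == p_ i :> SIdx d K)%:R = (i == j)%:R :> R by rewrite eq_sym.
pose dl (i j : 'I_d) : R := (i == j)%:R.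
(* One divergence per term of the generator; [T5] moves the second derivative
   of the diffusion term onto the density. *)
pose T1 i z := z (p_ i) * rho z * partial (th_ i) phi z
  + z (p_ i) * (ds i (theta_of z) * rho z) * phi z.
(* The last terms of [T1] and [T2] are opposite: transport against force. *)
pose T2 i z := ds i (theta_of z) * rho z * partial (p_ i) phi z
  - ds i (theta_of z) * (z (p_ i) * rho z) * phi z.
pose T3 i j z := - (xi z i j * z (p_ j) * rho z * partial (p_ i) phi z)
  - (xi z i j * dl i j * rho z - xi z i j * z (p_ j) * (z (p_ i) * rho z)) * phi z.
pose T4 i j z :=
  Amat Ak f (theta_of z) i j * rho z * partial (p_ i) (partial (p_ j) phi) z
  - Amat Ak f (theta_of z) i j * (z (p_ i) * rho z) * partial (p_ j) phi z.
pose T5 i j z := Amat Ak f (theta_of z) i j * z (p_ i) * rho z * partial (p_ j) phi z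
  + Amat Ak f (theta_of z) i j
    * (dl i j * rho z - z (p_ i) * (z (p_ j) * rho z)) * phi z.
(* The division by [eta k] cancels the [eta k] of the score in [xi_ k i j]. *)
pose T6 i j k z := f k (theta_of z) / eta k * (z (p_ i) * z (p_ j) - dl i j) * rho z
    * partial (xi_ k i j) phi z
  - f k (theta_of z) * (z (p_ i) * z (p_ j) - dl i j) * (z (xi_ k i j) - Ak k i j)
    * rho z * phi z.
(* In each of these facts the coefficient contains [rho], and compact support comes from [phi], or
   from its first derivative in the case of [T4]. *)
have N1 i : null_integral (T1 i).
  have := null_integral_partialM (has_partialM (dp i (th_ i)) (drho (th_ i)))
    (dphi _) CCphi (CCdphi _).
  by congr null_integral; apply/funext => z; rewrite /T1 /= mul0r addr0.
have N2 i : null_integral (T2 i).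
  have := null_integral_partialM (has_partialM (dds i (p_ i) isT) (drho (p_ i)))
    (dphi _) CCphi (CCdphi _).
  by congr null_integral; apply/funext => z; rewrite /T2 /=; ring.
have N3 i j : null_integral (T3 i j).
  have dc := has_partialM (has_partial_cst _ (-1))
    (has_partialM (has_partialM (dxi i j i) (dp j _)) (drho (p_ i))).
  have := null_integral_partialM dc (dphi _) CCphi (CCdphi _).
  by congr null_integral; apply/funext => z; rewrite /T3 /= pE /dl; ring.
have N4 i j : null_integral (T4 i j).
  have := null_integral_partialM (has_partialM (dA i j (p_ i) isT) (drho (p_ i)))
    (ddphi _ (p_ j)) (CCdphi _) (CCddphi _ _).
  by congr null_integral; apply/funext => z; rewrite /T4 /=; ring.
have N5 i j : null_integral (T5 i j).
  have dc := has_partialM (has_partialM (dA i j (p_ j) isT) (dp i (p_ j))) (drho (p_ j)).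
  have := null_integral_partialM dc (dphi _) CCphi (CCdphi _).
  by congr null_integral; apply/funext => z; rewrite /T5 /= pE /dl [j == i]eq_sym; ring.
have N6 i j k : null_integral (T6 i j k).
  have dpp := has_partialD (has_partialM (dp i (xi_ k i j)) (dp j (xi_ k i j)))
    (has_partial_cst _ (- dl i j)).
  have dc := has_partialM (has_partialM (df k (xi_ k i j) isT)
    (has_partial_cst _ (eta k)^-1)) dpp.
  have := null_integral_partialM (has_partialM dc (drho (xi_ k i j)))
    (dphi _) CCphi (CCdphi _).
  congr null_integral; apply/funext => z; rewrite /T6 /=; field.
  by rewrite gt_eqF.
rewrite (_ : (fun z => _) = fun z => \sum_i (T1 i z + T2 i z)
    + \sum_i \sum_j (T3 i j z + T4 i j z + T5 i j z + \sum_k T6 i j k z)).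
  apply: null_integralD.
    by apply: null_integral_sum => i; exact: null_integralD.
  apply: null_integral_sum => i; apply: null_integral_sum => j.
  apply: null_integralD; last exact: null_integral_sum.
  by apply: null_integralD => //; exact: null_integralD.
apply/funext => z; rewrite /generator.
(* The sum over [k] moves innermost, so that what remains can be checked for each pair [i], [j]
   separately. *)
have -> : \sum_(k < K.+1) f k (theta_of z) / eta k * \sum_(i < d) \sum_(j < d)
    (z (p_ i) * z (p_ j) - (i == j)%:R) * partial (xi_ k i j) phi z =
  \sum_(i < d) \sum_(j < d) \sum_(k < K.+1) f k (theta_of z) / eta k *
    ((z (p_ i) * z (p_ j) - (i == j)%:R) * partial (xi_ k i j) phi z).
  under eq_bigr do rewrite mulr_sumr.
  rewrite exchange_big; apply: eq_bigr => i _ /=.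
  under eq_bigr do rewrite mulr_sumr.
  by rewrite exchange_big.
under [X in _ - X]eq_bigr do rewrite mulr_suml.
rewrite -big_split /= -addrA -addrA [- _ + _]addrA -sumrN -2!big_split /=.
rewrite mulrDl !mulr_suml; congr (_ + _); apply: eq_bigr => i _.
  by rewrite /T1 /T2 /ds; ring.
rewrite -sumrN -2!big_split mulr_suml; apply: eq_bigr => j _ /=.
(* The decomposition of [Amat] on the [f k] enters here: the terms f_k ([xi_k]_ij - [A^k]_ij) add up
   to the entry of xi - A. The resulting multiple of [rho z * phi z] is opposite to what [T3], [T4]
   and [T5] leave. *)
have -> : \sum_k T6 i j k z =
    (\sum_k f k (theta_of z) / eta k *
      ((z (p_ i) * z (p_ j) - dl i j) * partial (xi_ k i j) phi z)) * rho z
    - (z (p_ i) * z (p_ j) - dl i j) * rho z * phi z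
      * (xi z i j - Amat Ak f (theta_of z) i j).
  rewrite /xi /Amat summxE -sumrB mulr_suml mulr_sumr -sumrB; apply: eq_bigr => k _.
  by rewrite mxE /T6; ring.
by rewrite /T3 /T4 /T5 /dl /xi; ring.
Qed.

End Invariance.

Theorem theorem4p1 (R : realType) (d K : nat)
  (pi_ : ('I_d -> R) -> R)
  (f : 'I_K.+1 -> ('I_d -> R) -> R)
  (Ak : 'I_K.+1 -> 'M[R]_d)
  (eta : 'I_K.+1 -> R) :
  smooth pi_ ->
  (forall th, 0 < pi_ th) ->
  smooth (fun th => ln (pi_ th)) ->
  eintegral_Rn pi_ = 1%E ->
  (forall k, smooth (f k)) ->
  (forall k, sym_mx (Ak k)) ->
  (forall th, posdef_mx (Amat Ak f th)) ->
  (exists S : ('I_d -> R) -> 'M[R]_d,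
      (forall th, possemidef_mx (S th) /\ S th *m S th = Amat Ak f th) /\
      (forall i j, smooth (fun th => S th i j))) ->
  (forall k, 0 < eta k) ->
  (forall phi : (SIdx d K -> R) -> R, smooth phi -> compact_support phi ->
     integral_Rn (fun z => generator pi_ Ak f eta phi z * nuK_density pi_ Ak eta z) = 0)
  /\
  (forall z : SIdx d K -> R,
     eiint [seq x <- enum (SIdx d K) | ~~ is_theta x] (nuK_density pi_ Ak eta) z
     = (pi_ (theta_of z))%:E).
Proof.
move=> _ pi0 slogpi _ sf _ _ _ eta0; split=> [phi sphi cphi|z].
  by have [] := null_integral_generator Ak pi0 slogpi sf eta0 sphi cphi.
exact: eiint_nuK_density.
Qed.
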